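(* Let $p$ be a prime. For all integers $n,m,k\geq 0$, $$A_{n+pm+k,\,k}\equiv A_{n+m+k,\,m+k}\pmod p.$$
   Context: A partition of a finite set is a collection of nonempty, pairwise disjoint subsets (blocks) whose union is the set; a singleton of a partition is a block with exactly one element. For integers $0\leq k\leq n$, $A_{n,k}$ denotes the number of partitions of $\{1,2,\dots,n+1\}$ whose largest singleton is $k+1$ (i.e. $\{k+1\}$ is a block and no $j>k+1$ forms a singleton block). *)

(* Defs.v *)
From mathcomp Require Import all_boot.

Set Implicit Arguments.
Unset Strict Implicit.
Unset Printing Implicit Defensive.

(* The ordinal i : 'I_n.+1 stands for the element i + 1 of {1, ..., n+1}. *)
Definition largest_singleton (n : nat) (P : {set {set 'I_n.+1}}) (i : 'I_n.+1) : bool :=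
  ([set i] \in P) && [forall j : 'I_n.+1, (i < j) ==> ([set j] \notin P)].

(* As k ranges over nat, the existential selects the ordinal of value k;
   the value is 0 outside the intended range k <= n. *)
Definition A (n k : nat) : nat :=
  #|[set P : {set {set 'I_n.+1}} |
       partition P [set: 'I_n.+1]
       & [exists i : 'I_n.+1, (val i == k) && largest_singleton P i]]|.

(* Main.v *)
Require Import Defs.
From mathcomp Require Import all_boot.
From HB Require Import structures.
From mathcomp Require Import all_algebra finfield.

Set Implicit Arguments.
Unset Strict Implicit.
Unset Printing Implicit Defensive.

Import GRing.Theory.

(** Let [L] be the linear functional on polynomials sending ['X^n] to the
    [n]-th Bell number.  Forbidding one more block [B] removes exactly the
    partitions that consist of [B] and a partition of the complement of [B];
    applied to the singletons [{j}] with [j > k + 1], this yields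
    [A n k = L ('X^k * ('X - 1) ^+ (n - k))].  The Bell recurrence reads
    [L ('X * f) = L (f \Po ('X + 1))], and iterating it
    [L ('X * ('X - 1) * ... * ('X - (p - 1)) * f) = L (f \Po ('X + p))].  In
    characteristic [p] this says [L (('X^p - 'X) * f) = L f], so that under
    [L] the factor [('X - 1) ^+ p = ('X^p - 'X) + ('X - 1)] may be replaced
    by ['X]. *)

Lemma big_subset_card (R : Type) (idx : R) (op : Monoid.com_law idx)
    (T : finType) (E : {set T}) (g : nat -> R) :
  \big[op/idx]_(C : {set T} | C \subset E) g #|C|
    = \big[op/idx]_(j < #|E|.+1) iter 'C(#|E|, j) (op (g j)) idx.
Proof.
rewrite (partition_big (fun C : {set T} => inord #|C| : 'I_#|E|.+1) xpredT) //=.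
apply: eq_bigr => j _; rewrite -cards_draws -big_const.
apply: congr_big => // [C|C /andP[sCE /eqP <-]].
  rewrite inE; apply: andb_id2l => sCE.
  by rewrite -val_eqE /= inordK // ltnS subset_leq_card.
by rewrite inordK // ltnS subset_leq_card.
Qed.

Lemma disjoint_setU1 (T : finType) (x : T) (A B : {set T}) :
  [disjoint x |: A & B] = (x \notin B) && [disjoint A & B].
Proof. by rewrite !disjoints_subset subUset sub1set inE. Qed.

Lemma imset_preimsetK (aT rT : finType) (f : aT -> rT) (D : {set aT})
    (C : {set rT}) :
  C \subset f @: D -> f @: (f @^-1: C) = C.
Proof.
move=> /subsetP sCfD; apply/setP => y; apply/imsetP/idP => [[x]|Cy].
  by rewrite inE => Cfx ->.
by have /imsetP[x _ y_fx] := sCfD y Cy; exists x; rewrite // inE -y_fx.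
Qed.

Lemma card_ord_ltn n k : k <= n -> #|[set j : 'I_n | j < k]| = k.
Proof.
move=> le_kn; rewrite -sum1dep_card -(big_ord_widen _ (fun=> 1)) //.
by rewrite sum1_card card_ord.
Qed.

Definition partitions (T : finType) (D : {set T}) : {set {set {set T}}} :=
  [set P | partition P D].

Definition partitions_avoiding (T : finType) (D : {set T})
    (F : {set {set T}}) : {set {set {set T}}} :=
  [set P in partitions D | [disjoint P & F]].

Definition singletons (T : finType) (S : {set T}) : {set {set T}} :=
  [set [set s] | s in S].

Definition bell (n : nat) : nat := #|partitions [set: 'I_n]|.

Section Partitions.

Variable T : finType.
Implicit Types (D B C S : {set T}) (F P Q : {set {set T}}) (x : T).

Lemma card_partitions_imset (T' : finType) (f : T -> T') D :
  injective f -> #|partitions (f @: D)| = #|partitions D|.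
Proof.
move=> inj_f; rewrite -(card_imset _ (imset_inj (imset_inj inj_f))).
apply: eq_card => Q; rewrite inE; apply/idP/imsetP => [parQ|[P]]; last first.
  by rewrite inE => parP ->; rewrite imset_partition.
pose P := [set f @^-1: (C : {set T'}) | C in Q].
have imPK : [set f @: (B : {set T}) | B in P] = Q.
  rewrite -imset_comp -[RHS]imset_id; apply: eq_in_imset => C QC /=.
  exact: imset_preimsetK (partitionS parQ QC).
by exists P; rewrite // inE -(imset_partition _ _ inj_f) imPK.
Qed.

Lemma partitions_avoiding0 D : partitions_avoiding D set0 = partitions D.
Proof. by apply/setP => P; rewrite inE -setI_eq0 setI0 eqxx andbT. Qed.

Lemma card_partitions_avoiding_block D F B :
    B \subset D -> B != set0 -> B \notin F ->
  #|[set P in partitions_avoiding D F | B \in P]|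
    = #|partitions_avoiding (D :\: B) F|.
Proof.
move=> sBD B_neq0 BF.
have notinB Q : Q \in partitions_avoiding (D :\: B) F -> B \notin Q.
  rewrite !inE => /andP[parQ _]; apply: contra B_neq0 => /(partitionS parQ).
  by rewrite subsetD => /andP[_]; rewrite -setI_eq0 setIid.
rewrite -[RHS](card_in_imset (f := fun Q => B |: Q)) => [|Q1 Q2]; last first.
  by move=> /notinB BQ1 /notinB BQ2 eqQ; rewrite -(setU1K BQ1) eqQ setU1K.
apply: eq_card => P; rewrite !inE; apply/idP/imsetP.
  move=> /andP[/andP[parP disPF] BP]; exists (P :\ B); last by rewrite setD1K.
  by rewrite !inE partitionD1 //= (disjointWl _ disPF) ?subsetDl.
case=> Q; rewrite !inE => /andP[parQ disQF] ->.
rewrite setU11 disjoint_setU1 BF disQF !andbT.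
have -> : D = B :|: (D :\: B) by rewrite -[LHS](setID D B) (setIidPr sBD).
by rewrite partitionU1 // -setI_eq0 setIDA setDIl setDv set0I.
Qed.

Lemma card_partitions_block D B : B \subset D -> B != set0 ->
  #|[set P in partitions D | B \in P]| = #|partitions (D :\: B)|.
Proof.
move=> sBD B_neq0.
by rewrite -!partitions_avoiding0 card_partitions_avoiding_block ?inE.
Qed.

Lemma card_partitions_avoidingU1 D F B :
    B \subset D -> B != set0 -> B \notin F ->
  #|partitions_avoiding D F|
    = #|partitions_avoiding D (B |: F)| + #|partitions_avoiding (D :\: B) F|.
Proof.
move=> sBD B_neq0 BF; rewrite -card_partitions_avoiding_block //.
rewrite -(cardsID [set P : {set {set T}} | B \in P]) addnC.
congr (_ + _); apply: eq_card => P; rewrite !inE //.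
by rewrite ![[disjoint P & _]]disjoint_sym disjoint_setU1 andbCA.
Qed.

Lemma card_partitions_avoiding_singletonsU1 D S x :
    x \notin D -> x \notin S ->
  #|partitions_avoiding (x |: D) (singletons S)|
    = #|partitions_avoiding (x |: D) (singletons (x |: S))|
      + #|partitions_avoiding D (singletons S)|.
Proof.
move=> xD xS; rewrite (@card_partitions_avoidingU1 _ _ [set x]).
- by rewrite setU1K // /singletons imsetU1.
- by rewrite sub1set setU11.
- by rewrite -card_gt0 cards1.
- by apply: contra xS => /imsetP[y yS /set1_inj ->].
Qed.

Lemma card_partitionsD1 D x : x \in D ->
  #|partitions D| = \sum_(C : {set T} | C \subset D :\ x) #|partitions C|.
Proof.
move=> xD; rewrite -sum1_card.
(* [C] is the complement of the block containing [x]. *)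
rewrite (partition_big (fun P => D :\: pblock P x)
          (fun C : {set T} => C \subset D :\ x)) /=; last first.
  move=> P; rewrite inE => parP.
  by rewrite setDS // sub1set mem_pblock (cover_partition parP).
apply: eq_bigr => C; rewrite subsetD1 => /andP[sCD xC].
have compK (E : {set T}) : E \subset D -> D :\: (D :\: E) = E.
  by move=> sED; rewrite setDDr setDv set0U; apply/setIidPr.
have xDC : x \in D :\: C by rewrite inE xC.
rewrite -[in RHS](compK C sCD) -card_partitions_block ?subsetDl //; last first.
  by apply/set0Pn; exists x.
rewrite sum1dep_card; apply: eq_card => P; rewrite !inE.
apply: andb_id2l => parP; apply/eqP/idP => [<-|DCP].
  have xP : pblock P x \in P by rewrite pblock_mem ?(cover_partition parP).
  by rewrite compK // (partitionS parP xP).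
by rewrite (def_pblock (partition_trivIset parP) DCP) // compK.
Qed.

End Partitions.

Lemma card_partitions (T : finType) (D : {set T}) : #|partitions D| = bell #|D|.
Proof.
have {1}-> : D = enum_val @: [set: 'I_#|D|].
  apply/setP => x; apply/idP/imsetP => [xD|[i _ ->]]; last exact: enum_valP.
  by exists (enum_rank_in xD x); rewrite // enum_rankK_in.
exact/card_partitions_imset/enum_val_inj.
Qed.

Lemma bellS n : bell n.+1 = \sum_(j < n.+1) 'C(n, j) * bell j.
Proof.
rewrite {1}/bell (card_partitionsD1 (in_setT ord0)).
under eq_bigr do rewrite card_partitions.
rewrite big_subset_card setTD cardsC1 card_ord.
by apply: eq_bigr => j _; rewrite iter_addn_0 mulnC.
Qed.

Local Open Scope ring_scope.

Section MomentFunctional.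

Variables (R : nzRingType) (mu : nat -> R).
Implicit Types f g : {poly R}.

Definition moment_functional f : R := \sum_(i < size f) f`_i * mu i.

Lemma moment_functional_wide n f : (size f <= n)%N ->
  moment_functional f = \sum_(i < n) f`_i * mu i.
Proof.
move=> le_fn; rewrite /moment_functional.
rewrite (big_ord_widen n (fun i => f`_i * mu i)) //.
rewrite big_mkcond; apply: eq_bigr => i _.
by case: ltnP => // le_fi; rewrite nth_default ?mul0r.
Qed.

Lemma moment_functional_is_linear : linear_for *%R moment_functional.
Proof.
move=> a f g; pose n := maxn (size f) (size g).
rewrite !(@moment_functional_wide n) ?leq_maxl ?leq_maxr //; last first.
  rewrite (leq_trans (size_polyD _ _)) // geq_max leq_maxr andbT.
  by rewrite (leq_trans (size_scale_leq _ _)) ?leq_maxl.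
rewrite mulr_sumr -big_split /=; apply: eq_bigr => i _.
by rewrite coefD coefZ mulrDl mulrA.
Qed.

HB.instance Definition _ :=
  GRing.isLinear.Build R {poly R} R *%R moment_functional
    moment_functional_is_linear.

Lemma moment_functionalXn n : moment_functional 'X^n = mu n.
Proof.
rewrite /moment_functional size_polyXn big_ord_recr /= coefXn eqxx mul1r.
by rewrite big1 ?add0r // => i _; rewrite coefXn ltn_eqF ?mul0r.
Qed.

End MomentFunctional.

Definition ffact_poly (R : nzRingType) (j : nat) : {poly R} :=
  \prod_(i < j) ('X - i%:R%:P).

Lemma ffact_poly_Fp p : prime p -> ffact_poly 'F_p p = 'X^p - 'X.
Proof.
move=> p_pr; have := finField_genPoly 'F_p; rewrite card_Fp // => ->.
rewrite /ffact_poly -(big_mkord xpredT (fun i => 'X - i%:R%:P)).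
rewrite -[X in index_iota 0 X](Fp_cast p_pr) big_mkord.
by apply: eq_bigr => i _; rewrite natr_Zp.
Qed.

Lemma map_ffact_poly (R S : nzRingType) (f : {rmorphism R -> S}) j :
  map_poly f (ffact_poly R j) = ffact_poly S j.
Proof.
rewrite rmorph_prod; apply: eq_bigr => i _.
by rewrite rmorphB /= map_polyX map_polyC /= rmorph_nat.
Qed.

Lemma ffact_poly_pchar (R : nzRingType) p :
  p \in [pchar R] -> ffact_poly R p = 'X^p - 'X.
Proof.
move=> pcharRp; have := map_ffact_poly (in_alg (pPrimeCharType pcharRp)) p.
rewrite ffact_poly_Fp ?(pcharf_prime pcharRp) //.
rewrite rmorphB /= map_polyXn map_polyX.
exact: esym.
Qed.

Notation bell_functional := (moment_functional (fun n => (bell n)%:R)).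

Section BellFunctional.

Variable R : comNzRingType.
Implicit Type f : {poly R}.

Lemma bell_functionalXM f :
  bell_functional ('X * f) = bell_functional (f \Po ('X + 1)).
Proof.
rewrite -[f]coefK poly_def mulr_sumr !raddf_sum /=; apply: eq_bigr => i _.
rewrite -scalerAr -exprS comp_polyZ comp_Xn_poly !linearZ /=; congr (_ * _).
rewrite moment_functionalXn bellS natr_sum addrC exprDn raddf_sum /=.
apply: eq_bigr => j _.
by rewrite expr1n mul1r raddfMn /= moment_functionalXn natrM mulr_natl.
Qed.

Lemma bell_functional_ffactM j f :
  bell_functional (ffact_poly R j * f) = bell_functional (f \Po ('X + j%:R%:P)).
Proof.
elim: j f => [|j IHj] f.
  by rewrite /ffact_poly big_ord0 mul1r addr0 comp_polyXr.
rewrite /ffact_poly big_ord_recr /= -mulrA IHj comp_polyM.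
rewrite comp_polyB comp_polyX comp_polyC addrK bell_functionalXM -comp_polyA.
by rewrite comp_polyD comp_polyX comp_polyC addrAC -addrA -polyCD natr1.
Qed.

Lemma card_partitions_avoiding_singletons (T : finType) (U S : {set T}) :
    [disjoint U & S] ->
  #|partitions_avoiding (U :|: S) (singletons S)|%:R
    = bell_functional ('X^#|U| * ('X - 1) ^+ #|S|) :> R.
Proof.
move cardS : #|S| => s; elim: s => [|s IHs] in U S cardS *.
  rewrite (cards0_eq cardS) /singletons imset0 setU0 partitions_avoiding0.
  by rewrite card_partitions expr0 mulr1 moment_functionalXn.
have [x xS] : exists x, x \in S by apply/set0Pn; rewrite -card_gt0 cardS.
move: cardS; rewrite -(setD1K xS).
move: (S :\ x) (setD11 x S) => S' /negbT xS'.
rewrite cardsU1 xS' disjoint_sym disjoint_setU1 => -[cardS'] /andP[xU disS'U].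
have disUS' : [disjoint U & S'] by rewrite disjoint_sym.
have xUS' : x \notin U :|: S' by rewrite inE (negbTE xU).
rewrite setUCA.
apply: (addIr #|partitions_avoiding (U :|: S') (singletons S')|%:R).
rewrite -natrD -card_partitions_avoiding_singletonsU1 // setUA.
rewrite !IHs ?disjoint_setU1 ?xS' // cardsU1 xU -raddfD /=.
by rewrite add1n exprSr -mulrA -mulrDr exprS mulrBl mul1r subrK.
Qed.

End BellFunctional.

Lemma A_card_partitions_avoiding n (i : 'I_n.+1) :
  A n i
    = #|partitions_avoiding [set~ i] (singletons [set j : 'I_n.+1 | i < j]%N)|.
Proof.
rewrite -setTD -card_partitions_avoiding_block ?subsetT //; first last.
- by apply/imsetP => -[j /[swap] /set1_inj <-]; rewrite inE ltnn.
- by rewrite -card_gt0 cards1.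
apply: eq_card => P; rewrite !inE -andbA; apply: andb_id2l => _.
apply/existsP/andP => [[j]|[disP iP]].
  move=> /andP[/eqP/val_inj-> /andP[iP /forallP no_larger]].
  split=> //; rewrite disjoint_sym disjoints_subset.
  apply/subsetP => _ /imsetP[s + ->]; rewrite !inE => lt_is.
  by have := no_larger s; rewrite lt_is.
exists i; rewrite eqxx /largest_singleton iP /=; apply/forallP => j.
by apply/implyP => lt_ij; rewrite (disjointFl disP) // imset_f ?inE.
Qed.

Lemma A_bell_functional (R : comNzRingType) n k : (k <= n)%N ->
  (A n k)%:R = bell_functional ('X^k * ('X - 1) ^+ (n - k)) :> R.
Proof.
rewrite -ltnS => lt_kn; pose i := Ordinal lt_kn.
pose smaller := [set j : 'I_n.+1 | j < i]%N.
pose larger := [set j : 'I_n.+1 | i < j]%N.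
have setC1_split : [set~ i] = smaller :|: larger.
  by apply/setP => j; rewrite !inE -val_eqE neq_ltn.
have disjoint_smaller_larger : [disjoint smaller & larger].
  by apply/pred0P => j; rewrite !inE; case: ltngtP.
have card_smaller : #|smaller| = k by rewrite card_ord_ltn // ltnW.
have card_larger : #|larger| = (n - k)%N.
  have : #|[set~ i]| = n by rewrite cardsC1 card_ord.
  rewrite setC1_split cardsU disjoint_setI0 // cards0 subn0 card_smaller.
  exact: canRL (addKn k).
rewrite (A_card_partitions_avoiding i) setC1_split.
by rewrite card_partitions_avoiding_singletons // card_smaller card_larger.
Qed.

Section Touchard.

Variables (R : comNzRingType) (p : nat) (pcharRp : p \in [pchar R]).
Implicit Type f : {poly R}.

Lemma touchard_congruence f :
  bell_functional (('X^p - 'X) * f) = bell_functional f.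
Proof.
rewrite -ffact_poly_pchar // bell_functional_ffactM.
by rewrite (pcharf0 pcharRp) addr0 comp_polyXr.
Qed.

Lemma bell_functional_subX1_exp_pchar f :
  bell_functional (('X - 1) ^+ p * f) = bell_functional ('X * f).
Proof.
have pcharXp : p \in [pchar {poly R}] by rewrite pchar_poly.
have -> : ('X - 1) ^+ p = 'X^p - 'X + ('X - 1) :> {poly R}.
  by rewrite addrA subrK -!(pFrobenius_autE pcharXp) rmorphB rmorph1.
by rewrite mulrDl raddfD /= touchard_congruence mulrBl mul1r raddfB addrC subrK.
Qed.

Lemma bell_functional_subX1_expM_pchar m f :
  bell_functional (('X - 1) ^+ (p * m) * f) = bell_functional ('X^m * f).
Proof.
elim: m f => [|m IHm] f; first by rewrite muln0 !expr0.
rewrite mulnS exprD -mulrA bell_functional_subX1_exp_pchar mulrCA IHm.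
by rewrite mulrA -exprSr.
Qed.

End Touchard.

Theorem theorem4p1 (p : nat) (hp : prime p) (n m k : nat) :
  A (n + p * m + k) k = A (n + m + k) (m + k) %[mod p].
Proof.
rewrite -!val_Fp_nat // -(addnA n m k) !A_bell_functional ?leq_addl //.
rewrite !addnK; congr (val _).
rewrite addnC exprD mulrCA bell_functional_subX1_expM_pchar ?pchar_Fp //.
by rewrite exprD mulrA.
Qed.
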